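(* Any full 1-specification ${\rm Q}_1=\{q_t^z, z\in\widehat{X_t}, t\in\mathbb{Z}^d\}$ specifies a random field $P_{{\rm Q}_1}$ such that $Q_1(P_{{\rm Q}_1})={\rm Q}_1$ for $P_{{\rm Q}_1}$-a.e. boundary conditions. That is, there exists a unique (positive) random field $P$ such that for every $t\in\mathbb{Z}^d$ and every nonempty (finite or infinite) $S\subset\mathbb{Z}^d\setminus\{t\}$, the one-point conditional probabilities $Q_t^z$ of $P$ satisfy $Q_t^z(x)=q_t^z(x)$ for all $x\in X^t$ and $P_S$-almost every $z\in X^S$ (hence for every $z\in X^S$ when $S$ is finite).
   Context: $X\subset\mathbb{R}$ is a finite set with $1<|X|<\infty$, and $d\ge 1$. For $S\subset\mathbb{Z}^d$, $W(S)$ is the set of all finite subsets of $S$, and $W=W(\mathbb{Z}^d)$. $X^S$ is the set of configurations on $S$ (functions $S\to X$); braces are omitted for one-point sets, e.g. $X^t=X^{\{t\}}$. For disjoint $S,T$ and $x\in X^S$, $y\in X^T$, $xy\in X^{S\cup T}$ is the concatenation; $z_\Lambda$ is the restriction of $z$ to $\Lambda$. For $V\in W$, $\widehat{X_V}=\bigcup_{\emptyset\neq S\subset\mathbb{Z}^d\setminus V}X^S$ (configurations with nonempty, finite or infinite, support outside $V$), $\widehat{X_t}=\widehat{X_{\{t\}}}$. The notation $\lim_{\Lambda\uparrow S}g_\Lambda(x_\Lambda)=a$ means that $\lim_n g_{\Lambda_n}(x_{\Lambda_n})=a$ for every increasing sequence of (nonempty) finite sets $\Lambda_n$ with $\bigcup_n\Lambda_n=S$.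 A random field is a probability measure $P$ on $X^{\mathbb{Z}^d}$ with the $\sigma$-algebra generated by cylinder sets; $P_S$ denotes its marginal on $X^S$, $S\subset\mathbb{Z}^d$. All random fields are assumed positive: $P_V(x)>0$ for all $V\in W$, $x\in X^V$. One-point conditional probabilities of $P$: for $z\in X^S$ with $\emptyset\neq S\in W(\mathbb{Z}^d\setminus\{t\})$, $Q_t^z(x)=P_{\{t\}\cup S}(xz)/P_S(z)$; for infinite $S\subset\mathbb{Z}^d\setminus\{t\}$, $Q_t^z(x)=\lim_{\Lambda\uparrow S}P_{\{t\}\cup\Lambda}(xz_\Lambda)/P_\Lambda(z_\Lambda)$ for $P_S$-almost every $z\in X^S$. A full 1-specification is a system ${\rm Q}_1=\{q_t^z, z\in\widehat{X_t}, t\in\mathbb{Z}^d\}$ of strictly positive probability distributions $q_t^z$ on $X^t$ such that: 1. for all distinct $t,s\in\mathbb{Z}^d$ and all $x\in X^t$, $y\in X^s$, $z\in\widehat{X_{\{t,s\}}}$, $q_t^z(x)\,q_s^{zx}(y)=q_s^z(y)\,q_t^{zy}(x)$; 2. for all $t\in\mathbb{Z}^d$ and nonempty $S\subset\mathbb{Z}^d\setminus\{t\}$, $q_t^z(x)=\lim_{\Lambda\uparrow S}q_t^{z_\Lambda}(x)$ for all $x\in X^t$, $z\in X^S$. *)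

(* Defs.v *)
From HB Require Import structures.
From mathcomp Require Import all_boot all_order all_algebra finmap.
From mathcomp Require Import all_classical all_reals all_analysis.

Set Implicit Arguments.
Unset Strict Implicit.
Unset Printing Implicit Defensive.

Import Order.TTheory GRing.Theory Num.Theory.
Import numFieldNormedType.Exports.

Local Open Scope classical_set_scope.
Local Open Scope ring_scope.

(* The elements of the finite set X. The proof that |X| > 1 is carried as a
   parameter only because measurable types must be pointed. *)
Definition state (R : realType) (X : {fset R}) (hX : (1 < #|` X|)%N) : Type := X.

Section State.
Context (R : realType) (X : {fset R}) (hX : (1 < #|` X|)%N).

HB.instance Definition _ := Finite.on (state hX).

Lemma state_inhabited : exists x : state hX, true.
Proof.
have /fset0Pn[x xX] : X != fset0 by rewrite -cardfs_gt0 (ltn_trans _ hX).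
by exists [` xX]%fset.
Qed.

HB.instance Definition _ := isPointed.Build (state hX) (xchoose state_inhabited).

End State.

Section Configurations.
Context (R : realType) (X : {fset R}) (hX : (1 < #|` X|)%N) (T : Type).
Implicit Types S V L : set T.

(* X^S: functions on the subtype {u : T | u \in S}. *)
Definition conf S : Type := S -> state hX.

HB.instance Definition _ S := Pointed.on (conf S).

Definition restr V S (VS : V `<=` S) (z : conf S) : conf V := z \o subfun VS.

(* The last branch is unreachable. *)
Definition concat S V (z : conf S) (y : conf V) : conf (S `|` V) := fun u =>
  if insub (val u) is Some s then z s
  else if insub (val u) is Some v then y v else point.

(* Configurations on one site are identified with elements of X. *)
Definition pt (t : T) (x : state hX) : conf [set t] := fun=> x.
Arguments pt : clear implicits.

Definition cylinders S : set (set (conf S)) :=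
  [set C | exists V (VS : V `<=` S) (x : conf V),
     finite_set V /\ C = restr VS @^-1` [set x]].

HB.instance Definition _ S :=
  @isMeasurable.Build (sigma_display (@cylinders S)) (conf S)
    <<s @cylinders S >> (@sigma_algebra0 _ setT _)
    (@sigma_algebraC _ _) (@sigma_algebra_bigcup _ setT _).

Lemma measurable_restr V S (VS : V `<=` S) :
  measurable_fun [set: conf S] (restr VS).
Proof.
apply: (@measurability _ _ _ _ _ _ (@cylinders V)) => //.
move=> _ [_ [W [WV [x [Wfin ->]]]] <-]; rewrite setTI.
apply: sub_sigma_algebra; exists W, (subset_trans WV VS), x; split=> //.
suff E z : restr WV (restr VS z) = restr (subset_trans WV VS) z.
  by apply/seteqP; split=> z /=; rewrite E.
by apply/funext => u; congr (z _); exact/val_inj.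
Qed.

HB.instance Definition _ V S (VS : V `<=` S) :=
  isMeasurableFun.Build _ _ _ _ (restr VS) (measurable_restr VS).

(* S is the support of a boundary condition outside V. *)
Definition outside V S := S !=set0 /\ S `<=` ~` V.

Definition exhausts (L : nat -> set T) S :=
  [/\ forall n, L n !=set0, forall n, finite_set (L n),
      nondecreasing_seq L & \bigcup_n L n = S].

(* The limit of g_L(z_L) as L increases to S is a. *)
Definition lim_up S (g : forall L, conf L -> R) (z : conf S) (a : R) :=
  forall (L : nat -> set T) (LS : forall n, L n `<=` S), exhausts L S ->
    g (L n) (restr (LS n) z) @[n --> \oo] --> a.

(* q t S z x stands for q_t^z(x); its values for S not outside {t} are
   irrelevant. *)
Definition kernels := forall (t : T) S, conf S -> state hX -> R.

Definition full_1_specification (q : kernels) :=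
  [/\ forall t S (z : conf S), outside [set t] S ->
        (forall x, 0 < q t S z x) /\ \sum_x q t S z x = 1,
      forall t s S (z : conf S) x y, t <> s -> outside [set t; s] S ->
        q t S z x * q s (S `|` [set t]) (concat z (pt t x)) y =
        q s S z y * q t (S `|` [set s]) (concat z (pt s y)) x
    & forall t S (z : conf S) x, outside [set t] S ->
        lim_up (fun L zL => q t L zL x) z (q t S z x)].

Definition random_field := probability (conf setT) R.

Definition marginal (P : random_field) S : probability (conf S) R :=
  distribution P (restr (@subsetT _ S)).

Definition prob (P : random_field) S (z : conf S) : R :=
  fine (marginal P S [set z]).

Definition positive_field (P : random_field) :=
  forall V (x : conf V), finite_set V -> 0 < prob P x.

Definition cond_ratio (P : random_field) t S (z : conf S) x : R :=
  prob P (concat (pt t x) z) / prob P z.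

(* The one-point conditional probability Q_t^z(x) of P exists and equals a. *)
Definition cond_prob (P : random_field) t S (z : conf S) x (a : R) :=
  (finite_set S -> cond_ratio P t z x = a) /\
  (infinite_set S -> lim_up (fun L zL => cond_ratio P t zL x) z a).

Definition specified_by (q : kernels) (P : random_field) :=
  forall t S, outside [set t] S ->
    {ae marginal P S, forall z, forall x, cond_prob P t z x (q t S z x)}.

End Configurations.
Arguments pt {R X hX T} t x.

(* Main.v *)
From HB Require Import structures.
Require Import Defs.
From mathcomp Require Import all_boot all_order all_algebra finmap.
From mathcomp Require Import all_classical all_reals all_analysis.
From mathcomp Require Import ring.

(** A boundary condition always has a nonempty support, so the specification
    prescribes how a finite configuration grows by one site but not how it
    starts. Once the distributions p_t at single sites are known, the finite
    marginals of the field must be the chain products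
      p_{t1}(x1) * q_{t2}^{x1}(x2) * q_{t3}^{x1 x2}(x3) * ...
    and everything rests on two facts about them.

    The p_t exist and are unique. Any field with these conditionals satisfies
      p_s(y) q_t^y(x) = p_t(x) q_s^x(y),
    and summation over x gives 1 / p_s(y) = sum_x q_t^y(x) / q_s^x(y): hence
    uniqueness. Conversely this formula defines a solution as soon as the sum
    does not depend on t. Writing the exchange condition 1 for three sites, each
    one in turn as the boundary condition, and multiplying gives the Kolmogorov
    cycle identity for the two-site conditionals, from which the independence
    and the normalization follow ([pairwise_marginals]).

    The chain products do not depend on the order of the sites, by the exchange
    condition ([weight_perm]), and summing out the last site of a chain gives
    the shorter chain ([weight_sum]). Along an enumeration of the lattice they
    are thus a consistent family, realized as a measure by cutting [0, 1[ into
    nested intervals of the prescribed lengths and pushing the Lebesgue measure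
    forward ([sequential_extension]). Because of the independence of the order,
    the marginal on every finite set, and not only on the initial segments of
    the enumeration, is a chain product ([field_of_weights]).

    So the ratio P(xz) / P(z) is q_t^z(x) for every finite z. For an infinite
    support the ratios along an exhausting sequence are thus values of q, and
    condition 2 is their convergence to q_t^z(x): the equality holds for every
    boundary condition, not merely for almost every one.
    Uniqueness: a positive field specified by q charges every finite
    configuration, so that its almost sure identities hold everywhere on finite
    supports; its finite marginals are then the chain products
    ([specified_weight]), and these determine the measure. *)

Set Implicit Arguments.
Unset Strict Implicit.
Unset Printing Implicit Defensive.

Import Order.TTheory GRing.Theory Num.Theory.

Local Open Scope classical_set_scope.
Local Open Scope ring_scope.

(** * Marginals from pairwise conditional probabilities *)

Section PairwiseConditionals.
Context (R : realFieldType) (I : eqType) (X : finType).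
Variable x0 : X.
(* k t s x y: the probability of x at t given y at s *)
Variable k : I -> I -> X -> X -> R.
Hypothesis k_gt0 : forall t s x y, t != s -> 0 < k t s x y.
Hypothesis k_sum1 : forall t s y, t != s -> \sum_x k t s x y = 1.

Let k_neq0 t s x y : t != s -> k t s x y != 0.
Proof. by move=> ts; rewrite gt_eqF ?k_gt0. Qed.

(** The reciprocal of the probability of y at s, as computed from the site t:
    each summand is the ratio of the probabilities of x at t and of y at s. *)
Definition inv_marginal t s y := \sum_x k t s x y / k s t y x.

Lemma inv_marginal_unique (p : I -> X -> R) t s y : t != s ->
    \sum_x p t x = 1 ->
    (forall x, p s y * k t s x y = p t x * k s t y x) ->
  p s y * inv_marginal t s y = 1.
Proof.
move=> ts p1 pk; rewrite -p1 mulr_sumr; apply: eq_bigr => x _.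
by rewrite mulrA pk mulfK // k_neq0 // eq_sym.
Qed.

Lemma inv_marginal_gt0 t s y : t != s -> 0 < inv_marginal t s y.
Proof.
move=> ts; have ratio_gt0 x : 0 < k t s x y / k s t y x.
  by rewrite divr_gt0 // k_gt0 // eq_sym.
rewrite /inv_marginal (bigD1 y) //= ltr_pwDl // sumr_ge0 // => x _.
exact: ltW.
Qed.

Let inv_marginal_neq0 t s y : t != s -> inv_marginal t s y != 0.
Proof. by move=> ts; rewrite gt_eqF ?inv_marginal_gt0. Qed.

Lemma pairwise_marginals_unique (p p' : I -> X -> R) t s y : t != s ->
    \sum_x p t x = 1 -> \sum_x p' t x = 1 ->
    (forall x, p s y * k t s x y = p t x * k s t y x) ->
    (forall x, p' s y * k t s x y = p' t x * k s t y x) ->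
  p s y = p' s y.
Proof.
move=> ts p1 p1' pk pk'; apply: (mulIf (inv_marginal_neq0 y ts)).
by rewrite (inv_marginal_unique ts p1 pk) (inv_marginal_unique ts p1' pk').
Qed.

(* Kolmogorov's criterion: the transition probabilities around the cycle
   z -> x -> y -> z have the same product in both directions. *)
Hypothesis cycle : forall t s r x y z, t != s -> s != r -> r != t ->
  k t r x z * k r s z y * k s t y x = k s r y z * k r t z x * k t s x y.

(** Summing the cycle identity over the state x of the auxiliary site t: the
    reciprocals computed from t satisfy the balance equation of s and r. *)
Lemma inv_marginal_cycle t s r y z : t != s -> s != r -> r != t ->
  k s r y z * inv_marginal t s y = k r s z y * inv_marginal t r z.
Proof.
move=> ts sr rt; rewrite !mulr_sumr; apply: eq_bigr => x _.
have E := cycle x y z ts sr rt.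
rewrite !mulrA; apply/eqP; rewrite eqr_div.
- by rewrite mulrAC -E [k t r x z * _]mulrC.
- by rewrite k_neq0 // eq_sym.
- by rewrite k_neq0.
Qed.

Hypothesis third : forall t s : I, exists r : I, (r != t) && (r != s).

(* the total mass of the candidate marginal at s computed from t *)
Let total t s := \sum_y (inv_marginal t s y)^-1.

Let total_indep t s r : t != s -> s != r -> r != t -> total t s = total t r.
Proof.
move=> ts sr rt; have tr : t != r by rewrite eq_sym.
have rs : r != s by rewrite eq_sym.
transitivity (\sum_y \sum_z k r s z y / inv_marginal t s y).
  by apply: eq_bigr => y _; rewrite -mulr_suml k_sum1 ?mul1r.
rewrite exchange_big; apply: eq_bigr => z _ /=.
rewrite -[RHS]mul1r -(k_sum1 z sr) mulr_suml; apply: eq_bigr => y _.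
apply/eqP; rewrite eqr_div ?inv_marginal_neq0 //.
by rewrite (inv_marginal_cycle _ _ ts sr rt).
Qed.

Let inv_marginal_total t s r z : t != s -> s != r -> r != t ->
  inv_marginal s r z = inv_marginal t r z * total t s.
Proof.
move=> ts sr rt; have tr : t != r by rewrite eq_sym.
have rs : r != s by rewrite eq_sym.
rewrite /total mulr_sumr; apply: eq_bigr => y _.
apply/eqP; rewrite eqr_div ?inv_marginal_neq0 ?k_neq0 //.
by rewrite (inv_marginal_cycle _ _ ts sr rt) mulrC.
Qed.

Let total_eq1 t s : t != s -> total t s = 1.
Proof.
move=> ts; have [r /andP[rt rs]] := third t s.
have sr : s != r by rewrite eq_sym.
rewrite /total; under eq_bigr do rewrite (inv_marginal_total _ rt ts sr) invfM.
rewrite -mulr_suml -/(total r s) -(total_indep rt ts sr) divff //.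
rewrite gt_eqF // /total (bigD1 x0) //= ltr_pwDl ?invr_gt0 ?inv_marginal_gt0 //.
by apply: sumr_ge0 => y _; rewrite invr_ge0 ltW // inv_marginal_gt0.
Qed.

(** The candidates at r computed from s and from t differ by the factor
    [total t s], which is 1: exchanging the roles of the sites and summing the
    same relation expresses it as a quotient of two equal masses. *)
Lemma inv_marginal_indep t s r z : t != s -> s != r -> r != t ->
  inv_marginal s r z = inv_marginal t r z.
Proof.
by move=> ts sr rt; rewrite (inv_marginal_total z ts sr rt) total_eq1 ?mulr1.
Qed.

Lemma pairwise_marginals : exists p : I -> X -> R,
  [/\ forall t x, 0 < p t x,
      forall t, \sum_x p t x = 1 &
      forall t s x y, t != s -> p s y * k t s x y = p t x * k s t y x].
Proof.
have /choice[wit witP] : forall s : I, exists t, t != s.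
  by move=> s; have [r /andP[rs _]] := third s s; exists r.
exists (fun s y => (inv_marginal (wit s) s y)^-1).
have witE t s y : t != s -> inv_marginal (wit s) s y = inv_marginal t s y.
  move=> ts; have [->//|wt] := eqVneq (wit s) t.
  by apply: inv_marginal_indep => //; rewrite eq_sym.
split=> [t x|t|t s x y ts]; first by rewrite invr_gt0 inv_marginal_gt0.
  exact: total_eq1.
have [r /andP[rt rs]] := third t s.
rewrite (witE r) // (witE r t) //; apply/eqP.
have sr : s != r by rewrite eq_sym.
rewrite ![_^-1 * _]mulrC eqr_div ?inv_marginal_neq0 //.
by rewrite (inv_marginal_cycle _ _ rt ts sr).
Qed.
End PairwiseConditionals.

(** * Coding sequences by nested intervals *)

Definition upd (T : eqType) (X : Type) (f : T -> X) (t : T) (x : X) : T -> X :=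
  fun u => if u == t then x else f u.

Lemma upd_id (T : eqType) (X : Type) (f : T -> X) t : upd f t (f t) = f.
Proof. by apply/funext => u; rewrite /upd; case: eqP => [->|]. Qed.

(** The interval of a word of length n has length w n; the intervals of its
    one-letter extensions follow each other from left to right in the order of
    [enum X]. A word is given as an infinite sequence of which only the first n
    terms matter. *)
Section Coding.
Context (R : realType) (X : finType) (x0 : X).
Variable w : nat -> (nat -> X) -> R.
Hypothesis w0 : forall s, w 0 s = 1.
Hypothesis w_ge0 : forall n s, 0 <= w n s.
Hypothesis w_ext : forall n s s',
  (forall i, (i < n)%N -> s i = s' i) -> w n s = w n s'.
Hypothesis w_sum : forall n s, \sum_x w n.+1 (upd s n x) = w n s.

Let children n s k :=
  \sum_(0 <= i < k) w n.+1 (upd s n (nth x0 (enum X) i)).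

Fixpoint left_end n (s : nat -> X) : R :=
  if n is m.+1 then left_end m s + children m s (index (s m) (enum X)) else 0.

Definition code_itv n s : set R :=
  [set` `[left_end n s, left_end n s + w n s[].

Let upd_agree n (s s' : nat -> X) x : (forall i, (i < n)%N -> s i = s' i) ->
  forall i, (i < n.+1)%N -> upd s n x i = upd s' n x i.
Proof.
move=> ss i; rewrite ltnS leq_eqVlt /upd.
by case: eqP => //= _ /ss.
Qed.

Let children_ext n s s' k : (forall i, (i < n)%N -> s i = s' i) ->
  children n s k = children n s' k.
Proof.
by move=> ss; apply: eq_bigr => i _; apply: w_ext; exact: upd_agree.
Qed.

Lemma left_end_ext n s s' :
  (forall i, (i < n)%N -> s i = s' i) -> left_end n s = left_end n s'.
Proof.
elim: n => //= n IH ss; rewrite IH => [|i ni]; last by rewrite ss // ltnW.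
by rewrite ss //; congr (_ + _); apply: children_ext => i ni; rewrite ss // ltnW.
Qed.

Lemma code_itv_ext n s s' :
  (forall i, (i < n)%N -> s i = s' i) -> code_itv n s = code_itv n s'.
Proof. by move=> ss; rewrite /code_itv (left_end_ext ss) (w_ext ss). Qed.

Let children_le n s k l : (k <= l)%N -> children n s k <= children n s l.
Proof.
move=> kl; rewrite /children [leRHS](@big_cat_nat _ _ _ k)//= lerDl.
by apply: sumr_ge0.
Qed.

Let children_all n s : children n s #|X| = w n s.
Proof.
rewrite -w_sum /children cardE.
by rewrite -(big_nth _ predT (fun x => w n.+1 (upd s n x))) big_enum.
Qed.

(* The subinterval of s lies between two consecutive partial sums, the form in
   which adjacent subintervals are compared. *)
Let code_itvSE n s : code_itv n.+1 s =
  [set` `[left_end n s + children n s (index (s n) (enum X)),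
          left_end n s + children n s (index (s n) (enum X)).+1[].
Proof.
rewrite /code_itv /= /children [in RHS]big_nat_recr //= nth_index ?mem_enum //.
by rewrite upd_id addrA.
Qed.

Lemma code_itv_sub n s : code_itv n.+1 s `<=` code_itv n s.
Proof.
rewrite code_itvSE => u /=; rewrite !in_itv /= => /andP[lu ur]; apply/andP; split.
  by apply: le_trans lu; rewrite lerDl sumr_ge0.
apply: (lt_le_trans ur); rewrite lerD2l -children_all children_le //.
by rewrite cardE index_mem mem_enum.
Qed.

Lemma code_itv_inj n s s' u : code_itv n s u -> code_itv n s' u ->
  forall i, (i < n)%N -> s i = s' i.
Proof.
elim: n => // n IH su s'u.
have ss := IH (code_itv_sub su) (code_itv_sub s'u).
have ssn : s n = s' n.
  move: su s'u; rewrite !code_itvSE (left_end_ext ss) /=.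
  set k := index (s n) _; set l := index _ _.
  rewrite !(children_ext _ ss) !in_itv /= => /andP[ku uk] /andP[lu ul].
  have /(congr1 (nth x0 (enum X))) : k = l.
    apply/eqP; rewrite eqn_leq; apply/andP; split.
      rewrite leqNgt; apply/negP => /(children_le n s') lk.
      by move: (le_lt_trans ku ul); rewrite ltrD2l ltNge lk.
    rewrite leqNgt; apply/negP => /(children_le n s') kl.
    by move: (le_lt_trans lu uk); rewrite ltrD2l ltNge kl.
  by rewrite !nth_index ?mem_enum.
move=> i; rewrite ltnS leq_eqVlt => /orP[/eqP ->//|]; exact: ss.
Qed.

Lemma code_itv_split n s u : code_itv n s u ->
  exists x, code_itv n.+1 (upd s n x) u.
Proof.
rewrite {1}/code_itv /= in_itv /= -children_all => /andP[lu].
have : (#|X| <= size (enum X))%N by rewrite cardE.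
elim: #|X| => [_|k IH kX uk].
  by rewrite /children big_geq // addr0 ltNge lu.
have [uk'|ku] := ltP u (left_end n s + children n s k).
  by apply: IH => //; exact: ltnW.
exists (nth x0 (enum X) k); rewrite code_itvSE /=.
have -> : upd s n (nth x0 (enum X) k) n = nth x0 (enum X) k.
  by rewrite /upd eqxx.
rewrite index_uniq ?enum_uniq //.
have ss : forall i, (i < n)%N -> upd s n (nth x0 (enum X) k) i = s i.
  by move=> i ni; rewrite /upd ltn_eqF.
by rewrite (left_end_ext ss) !(children_ext _ ss) in_itv /= ku uk.
Qed.

(** Every level of the subdivision covers [0, 1[, and the words of different
    levels found for the same point extend each other by [code_itv_inj]; the
    diagonal sequence therefore lies in all of its own intervals. *)
Lemma code_exists u : 0 <= u < 1 -> exists s, forall n, code_itv n s u.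
Proof.
move=> u01.
have /choice [s su] : forall n, exists s, code_itv n s u.
  elim=> [|n [s /code_itv_split[x xu]]]; last by exists (upd s n x).
  by exists (fun=> x0); rewrite /code_itv /= w0 add0r in_itv.
have sub n m : (n <= m)%N -> code_itv n (s m) u.
  move=> nm; move: (s m) (su m); elim: m nm => [|m IH].
    by rewrite leqn0 => /eqP ->.
  by rewrite leq_eqVlt => /orP[/eqP ->//|nm t /code_itv_sub]; exact: IH.
exists (fun i => s i.+1 i) => n.
rewrite (@code_itv_ext n _ (s n)) // => i ni.
by apply: (code_itv_inj (su i.+1) (sub _ _ ni)).
Qed.

End Coding.

(** * Random fields with prescribed marginals along an enumeration *)

Section Fields.
Context (R : realType) (X : {fset R}) (hX : (1 < #|` X|)%N) (T : choiceType).
Local Notation X' := (state hX).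

(** Configurations on a set of sites are handled as restrictions of functions on
    all of T: concatenation becomes restriction to a union, and transport
    between different subtypes is avoided. *)
Definition res (S : set T) (s : T -> X') : conf hX S := fun u => s (val u).
Arguments res : clear implicits.

Lemma restr_res V S (VS : V `<=` S) s : restr VS (res S s) = res V s.
Proof. by []. Qed.

Lemma res_surj S (z : conf hX S) : exists s, z = res S s.
Proof.
exists (fun t => if insub t is Some u then z u else point).
by apply/funext => u; rewrite /res valK.
Qed.

Lemma res_eq S s s' : res S s = res S s' <-> {in S, s =1 s'}.
Proof.
split=> [E t tS|E]; first by have := congr1 (fun z => z (SigSub tS)) E.
by apply/funext => u; apply: E; exact: valP.
Qed.

Definition cyl S (s : T -> X') : set (conf hX [set: T]) :=
  restr (@subsetT _ S) @^-1` [set res S s].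

Lemma cylE S s s' : cyl S s (res setT s') <-> {in S, s' =1 s}.
Proof. exact: res_eq. Qed.

Lemma measurable_cyl S s : finite_set S -> measurable (cyl S s).
Proof.
by move=> Sfin; apply: sub_sigma_algebra; exists S, (@subsetT _ S), (res S s).
Qed.

Section Extension.
Variables (e : nat -> T) (w : nat -> (T -> X') -> R).
Hypothesis e_bij : bijective e.
Hypothesis w0 : forall s, w 0 s = 1.
Hypothesis w_ge0 : forall n s, 0 <= w n s.
Hypothesis w_ext : forall n s s',
  (forall i, (i < n)%N -> s (e i) = s' (e i)) -> w n s = w n s'.
Hypothesis w_sum : forall n s, \sum_x w n.+1 (upd s (e n) x) = w n s.

(** The law of the code of a uniformly distributed point of [0, 1[: the points
    whose code begins with a given word form the interval of that word, of
    length w n s. *)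
Lemma sequential_extension : exists P : random_field hX T,
  forall n s, P (cyl (e @` `I_n) s) = (w n s)%:E.
Proof.
case: e_bij => f eK fK.
pose v n (a : nat -> X') := w n (a \o f).
have v_ext n a a' : (forall i, (i < n)%N -> a i = a' i) -> v n a = v n a'.
  by move=> aa; apply: w_ext => i ni /=; rewrite !eK aa.
have v_sum n a : \sum_x v n.+1 (upd a n x) = v n a.
  rewrite /v -w_sum; apply: eq_bigr => x _; apply: w_ext => i ni.
  by rewrite /upd /= eK (inj_eq (can_inj eK)).
pose J := code_itv (point : X') v.
have v_ge0 n a : 0 <= v n a by exact: w_ge0.
have [code [codeJ code0]] : exists c : R -> nat -> X',
    (forall u, 0 <= u < 1 -> forall n, J n (c u) u) /\
    (forall u, ~~ (0 <= u < 1) -> c u = fun=> point).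
  have /choice[c cP] : forall u : R, exists a : nat -> X',
      (0 <= u < 1 -> forall n, J n a u) /\ (~~ (0 <= u < 1) -> a = fun=> point).
    move=> u; have [u01|_] := boolP (0 <= u < 1); last by exists (fun=> point).
    have [a au] := code_exists (point : X') (fun=> w0 _) v_ge0 v_ext v_sum u01.
    by exists a.
  by exists c; split=> u; have [] := cP u.
pose D : set R := [set` `[0, 1[].
have J0 a : J 0%N a = D by rewrite /J /code_itv /v w0 add0r.
have JD n a : J n a `<=` D.
  elim: n => [|n IH]; first by rewrite J0.
  by move=> u /(code_itv_sub v_ge0 v_sum)/IH.
pose E n (a : nat -> X') : set R :=
  [set u | forall i, (i < n)%N -> code u i = a i].
have ED n a : E n a `&` D = J n a.
  apply/seteqP; split=> u.
    move=> [ua]; rewrite /D /= in_itv /= => /codeJ/(_ n).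
    by rewrite /J -(code_itv_ext _ v_ext ua).
  move=> ua; split; last exact: JD ua.
  have := JD _ _ _ ua; rewrite /D /= in_itv /= => /codeJ/(_ n) uc.
  exact: (code_itv_inj v_ge0 v_ext v_sum uc ua).
(* The code is constant off D, so E n a contains all of its complement or
   nothing of it. *)
have mE n a : measurable (E n a : set (measurableTypeR R)).
  have [Ec|nEc] := pselect (E n a `<=` D).
    by rewrite -(setIidl Ec) ED; exact: measurable_itv.
  suff -> : E n a = J n a `|` ~` D.
    by apply: measurableU; [|apply: measurableC]; exact: measurable_itv.
  have out u : ~ D u -> code u = fun=> point.
    by rewrite /D /= in_itv /= => /negP/code0.
  have ca i : (i < n)%N -> point = a i.
    move=> ni; apply: contrapT => pa; apply: nEc => u ua.
    by apply: contrapT => /out uc; apply: pa; rewrite -ua // uc.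
  rewrite -ED; apply/seteqP; split=> [u ua|u [[]//|]].
    by have [|] := pselect (D u); [left|right].
  by move=> /out uc i ni; rewrite uc -ca.
have mcode1 i x : measurable ([set u | code u i = x] : set (measurableTypeR R)).
  pose F (l : seq X') : set (measurableTypeR R) :=
    if nth point l i == x then E i.+1 (nth point l) else set0.
  suff -> : [set u | code u i = x] = \bigcup_l F l.
    apply: countable_bigcupT_measurable => [|l]; first exact: countableP.
    by rewrite /F; case: ifP.
  apply/seteqP; split=> u /=.
    move=> ux; exists (mkseq (code u) i.+1) => //.
    rewrite /F nth_mkseq // ux eqxx.
    by move=> j ji; rewrite nth_mkseq.
  by move=> [l _]; rewrite /F; case: eqP => // <- -> .
(* f enumerates the sites: the letter of rank f t becomes the state of t. *)
pose phi (u : measurableTypeR R) := res [set: T] (code u \o f).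
have mphi : measurable_fun [set: measurableTypeR R] phi.
  apply: (@measurability _ _ _ _ _ _ (@cylinders _ _ hX _ [set: T])) => //.
  move=> _ [_ [V [VT [x [Vfin ->]]]] <-]; rewrite setTI.
  have [s ->] := res_surj x.
  suff -> : phi @^-1` (restr VT @^-1` [set res V s]) =
      \bigcap_(t in V) [set u | code u (f t) = s t].
    by apply: fin_bigcap_measurable.
  apply/seteqP; split=> u /=; rewrite restr_res res_eq => ut t.
    by move=> tV; apply: ut; rewrite inE.
  by rewrite inE => /ut.
pose U : probability (measurableTypeR R) R :=
  uniform_prob (ltr01 : (0 : R) < 1).
pose Phi : {mfun measurableTypeR R >-> conf hX [set: T]} :=
  HB.pack phi (isMeasurableFun.Build _ _
    (measurableTypeR R) (conf hX [set: T]) phi mphi).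
exists (distribution U Phi) => n s.
transitivity (U (E n (s \o e))).
  congr (U _); apply/seteqP; split=> u; rewrite /= cylE => us i.
    by move=> ni; have := us (e i); rewrite inE /= eK; apply; exists i.
  by rewrite inE => -[j jn <-] /=; rewrite eK us.
have PJ m a : U (J m a) = (v m a)%:E.
  have J01 : J m a `<=` `[0, 1].
    by move=> u /JD; rewrite /D /= !in_itv /= => /andP[-> /ltW ->].
  rewrite /U /= /uniform_prob integral_uniform_pdf (setIidl J01).
  under eq_integral => u /[!inE] /J01.
    rewrite /= in_itv /= => u01; rewrite /uniform_pdf u01 subr0 invr1; over.
  rewrite integral_cst ?mul1e; last exact: measurable_itv.
  rewrite [LHS](lebesgue_measure_itv
    `[left_end (point : X') v m a, left_end (point : X') v m a + v m a[).
  rewrite /= lte_fin ltrDl.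
  case: ltP => [_|v0]; first by rewrite -EFinB addrAC subrr add0r.
  by congr _%:E; apply/eqP; rewrite eq_le v0 v_ge0.
have PD : U (~` D) = 0%E.
  rewrite probability_setC; last exact: measurable_itv.
  by rewrite -(J0 (fun=> point)) PJ /v w0 subee.
have mD : measurable (D : set (measurableTypeR R)) by exact: measurable_itv.
have EDc0 : U (E n (s \o e) `\` D) = 0%E.
  apply: (@subset_measure0 _ _ _ U _ (~` D)) => //.
  - exact: measurableD.
  - exact: measurableC.
rewrite (measureDI U (mE n (s \o e)) mD) ED.
transitivity (0 + (v n (s \o e))%:E)%E.
  by congr (_ + _)%E; [exact: EDc0|exact: PJ].
by rewrite add0e /v; congr _%:E; apply: w_ext => i ni /=; rewrite eK.
Qed.
End Extension.
End Fields.
Arguments res {R X hX T} S s u.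

(** * Finite-dimensional marginals *)

Section Marginals.
Context (R : realType) (X : {fset R}) (hX : (1 < #|` X|)%N) (T : choiceType).
Local Notation X' := (state hX).
Implicit Types (S V : set T) (s : T -> X') (P : random_field hX T).

Lemma upd_same s t x : upd s t x t = x.
Proof. by rewrite /upd eqxx. Qed.

Lemma upd_other s t x u : u != t -> upd s t x u = s u.
Proof. by rewrite /upd => /negbTE ->. Qed.

Lemma res_upd S s t x : ~ S t -> res S (upd s t x) = res S s.
Proof.
move=> St; apply/res_eq => u; rewrite inE => Su.
by rewrite upd_other //; apply: contra_notN St => /eqP <-.
Qed.

Lemma pt_res t s : pt t (s t) = res [set t] s.
Proof. by apply/funext => u; rewrite /pt /res; have /[!inE] -> := valP u. Qed.

Lemma concat_res S V s : concat (res S s) (res V s) = res (S `|` V) s.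
Proof.
apply/funext => u; rewrite /concat; case: insubP => [v _ vu|uS].
  by rewrite /res vu.
case: insubP => [v _ vu|uV]; first by rewrite /res vu.
by have := valP u; rewrite in_setU (negbTE uS) (negbTE uV).
Qed.

Lemma concat_pt S s t x : ~ S t ->
  concat (pt t x) (res S s) = res (t |` S) (upd s t x).
Proof.
by move=> St; rewrite -(res_upd s x St) -{1}(upd_same s t x) pt_res concat_res.
Qed.

Lemma probE P S s : finite_set S -> P (cyl S s) = (prob P (res S s))%:E.
Proof.
move=> Sfin; rewrite /prob fineK //.
change (P (cyl S s) \is a fin_num); apply: fin_num_measure.
exact: measurable_cyl.
Qed.

Lemma prob_total P s : prob P (res set0 s) = 1.
Proof.
apply: (@EFin_inj R); rewrite -probE // -(probability_setT P); congr (P _).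
apply/seteqP; split=> // z _; have [s' ->] := res_surj z.
by apply/cylE => u; rewrite inE.
Qed.

Lemma prob_sum P S s t : finite_set S -> ~ S t ->
  prob P (res S s) = \sum_x prob P (res (t |` S) (upd s t x)).
Proof.
move=> Sfin St; apply: (@EFin_inj R); rewrite -probE // -sumEFin.
have tSfin : finite_set (t |` S).
  by rewrite finite_setU; split=> //; exact: finite_set1.
have -> : cyl S s = \bigcup_(x in [set` enum {: X'}]) cyl (t |` S) (upd s t x).
  apply/seteqP; split=> z; have [s' ->] := res_surj z.
    move/cylE => ss; exists (s' t); first by rewrite /= mem_enum.
    apply/cylE => u; rewrite inE => -[->|uS]; first by rewrite upd_same.
    have [->|ut] := eqVneq u t; first by rewrite upd_same.
    by rewrite upd_other // ss // inE.
  move=> [x _ /cylE ss]; apply/cylE => u uS; rewrite ss ?inE; last first.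
    by right; rewrite inE in uS.
  rewrite upd_other //; apply: contra_notN St => /eqP <-.
  by rewrite inE in uS.
rewrite measure_fin_bigcup //.
- rewrite -fsbig_seq ?enum_uniq // big_enum /=; apply: eq_bigr => x _.
  by rewrite probE.
- move=> x y _ _ [z [/=]]; have [s' ->] := res_surj z.
  move=> /cylE sx /cylE sy; have tin : t \in t |` S by rewrite inE; left.
  by have := sx _ tin; rewrite sy // !upd_same.
- by move=> x _; exact: measurable_cyl.
Qed.

(** Cylinders form a pi-system once the empty set is added: two cylinders with a
    common point are both determined by it, and so is their intersection. *)
Lemma random_field_unique P P' :
  (forall S s, finite_set S -> prob P (res S s) = prob P' (res S s)) ->
  forall A, measurable A -> P A = P' A.
Proof.
move=> PP' A mA.
pose G := @cylinders R X hX T [set: T] `|` [set set0].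
have cG S s : finite_set S -> G (cyl S s).
  by move=> Sfin; left; exists S, (@subsetT _ S), (res S s).
have GP C : G C -> C = set0 \/ exists S s, finite_set S /\ C = cyl S s.
  case=> [[S [ST [x [Sfin ->]]]]|->]; last by left.
  right; have [s ->] := res_surj x; exists S, s; split=> //.
  by rewrite (Prop_irrelevance ST (@subsetT _ S)).
have mG : G `<=` measurable.
  move=> C /GP[->|[S [s [Sfin ->]]]]; [exact: measurable0|exact: measurable_cyl].
have cT : cyl set0 (fun=> point) = [set: conf hX [set: T]].
  apply/seteqP; split=> // z _; have [s ->] := res_surj z.
  by apply/cylE => u; rewrite inE.
apply: (@g_sigma_algebra_measure_unique _ _ _ G mG (fun=> setT)) => //.
- by move=> _; rewrite -cT; apply: cG.
- by rewrite bigcup_const.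
- move=> C C' /GP[->|[S [s [Sfin ->]]]]; first by rewrite set0I; right.
  move=> /GP[->|[S' [s' [Sfin' ->]]]]; first by rewrite setI0; right.
  have [[z []]|nz] := pselect (cyl S s `&` cyl S' s' !=set0); last first.
    by right; apply: contrapT => /eqP/set0P.
  have [r ->] := res_surj z => /cylE rs /cylE rs'.
  suff -> : cyl S s `&` cyl S' s' = cyl (S `|` S') r.
    by apply: cG; rewrite finite_setU.
  apply/seteqP; split=> y; have [s1 ->] := res_surj y.
    move=> [/cylE ss /cylE ss']; apply/cylE => u; rewrite in_setU => /orP[uS|uS].
      by rewrite ss // rs.
    by rewrite ss' // rs'.
  move=> /cylE sr; split; apply/cylE => u uS.
    by rewrite sr ?rs // in_setU uS.
  by rewrite sr ?rs' // in_setU uS orbT.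
- move=> C /GP[->|[S [s [Sfin ->]]]]; first by rewrite !measure0.
  have : P (cyl S s) = P' (cyl S s) by rewrite !probE // PP'.
  exact.
- by move=> _; apply: le_lt_trans (probability_le1 P measurableT) (ltry 1).
- by apply: sub_sigma_algebra2 mA; left.
Qed.

End Marginals.

(** * Chain products of a 1-specification *)

Section Specification.
Context (R : realType) (X : {fset R}) (hX : (1 < #|` X|)%N) (T : choiceType).
Local Notation X' := (state hX).
Variable q : kernels hX T.
Hypothesis q_spec : full_1_specification q.
Implicit Types (S V : set T) (s : T -> X') (P : random_field hX T).

Definition cond t S s : R := q t (res S s) (s t).

Lemma outside_set1 t S : S !=set0 -> ~ S t -> outside [set t] S.
Proof. by move=> S0 St; split=> // u Su ut; apply: St; rewrite -ut. Qed.

Lemma cond_gt0 t S s : S !=set0 -> ~ S t -> 0 < cond t S s.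
Proof.
move=> S0 St; have [q1 _ _] := q_spec.
by have [/(_ (s t))] := q1 t S (res S s) (outside_set1 S0 St).
Qed.

Lemma cond_sum t S s : S !=set0 -> ~ S t -> \sum_x cond t S (upd s t x) = 1.
Proof.
move=> S0 St; have [q1 _ _] := q_spec.
have [_ <-] := q1 t S (res S s) (outside_set1 S0 St).
by apply: eq_bigr => x _; rewrite /cond res_upd // upd_same.
Qed.

Lemma cond_ext t S s s' : {in t |` S, s =1 s'} -> cond t S s = cond t S s'.
Proof.
move=> ss; rewrite /cond ss ?in_setU ?in_set1 ?eqxx //; congr (q _ _ _).
by apply/res_eq => u uS; rewrite ss // in_setU uS orbT.
Qed.

Lemma cond_swap (t s : T) S r : t != s -> S !=set0 -> ~ S t -> ~ S s ->
  cond t S r * cond s (t |` S) r = cond s S r * cond t (s |` S) r.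
Proof.
move=> /eqP ts S0 St Ss; have [_ q2 _] := q_spec.
have o : outside [set t; s] S.
  by split=> // u Su [ut|us]; [apply: St; rewrite -ut|apply: Ss; rewrite -us].
have := q2 t s S (res S r) (r t) (r s) ts o.
by rewrite !pt_res !concat_res ![S `|` _]setUC.
Qed.

Definition pair_cond (t s : T) (x y : X') : R := q t (pt s y) x.

Lemma pair_condE (t s : T) r : cond t [set s] r = pair_cond t s (r t) (r s).
Proof. by rewrite /cond /pair_cond pt_res. Qed.

Lemma set1_nonempty (t : T) : [set t] !=set0.
Proof. by exists t. Qed.

Lemma notin_set1 (t s : T) : t != s -> ~ [set s] t.
Proof. by move=> /eqP ts /= E; apply: ts. Qed.

Lemma pair_cond_gt0 (t s : T) x y : t != s -> 0 < pair_cond t s x y.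
Proof.
move=> ts; pose r := upd (fun=> y) t x.
have -> : pair_cond t s x y = cond t [set s] r.
  by rewrite pair_condE /r upd_same upd_other // eq_sym.
by apply: cond_gt0; [exists s|exact: notin_set1].
Qed.

Lemma pair_cond_sum (t s : T) y : t != s -> \sum_x pair_cond t s x y = 1.
Proof.
move=> ts; rewrite -(@cond_sum t [set s] (fun=> y)).
- apply: eq_bigr => x _.
  by rewrite pair_condE upd_same upd_other // eq_sym.
- by exists s.
- exact: notin_set1.
Qed.

(** The product of the three exchange identities in which t, s and r in turn
    carry the boundary condition; the conditionals given two sites appear once
    on each side and cancel. *)
Lemma pair_cond_cycle (t s r : T) x y z : t != s -> s != r -> r != t ->
  pair_cond t r x z * pair_cond r s z y * pair_cond s t y x =
  pair_cond s r y z * pair_cond r t z x * pair_cond t s x y.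
Proof.
move=> ts sr rt.
have [st rs tr] : [/\ s != t, r != s & t != r] by split; rewrite eq_sym.
pose c := upd (upd (fun=> z) s y) t x.
have [ct cs cr] : [/\ c t = x, c s = y & c r = z].
  by split; rewrite /c ?upd_same // upd_other ?upd_same // upd_other.
have E1 := @cond_swap t s [set r] c ts (set1_nonempty r)
  (notin_set1 tr) (notin_set1 sr).
have E2 := @cond_swap s r [set t] c sr (set1_nonempty t)
  (notin_set1 st) (notin_set1 rt).
have E3 := @cond_swap r t [set s] c rt (set1_nonempty s)
  (notin_set1 rs) (notin_set1 ts).
have A0 u v w' : u != v -> u != w' -> cond u [set v; w'] c != 0.
  move=> uv uw; rewrite gt_eqF // cond_gt0 //; first by exists v; left.
  by case; exact: notin_set1.
move: E1 E2 E3; rewrite !pair_condE ct cs cr.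
rewrite [r |` [set t]]setUC [s |` [set t]]setUC [r |` [set s]]setUC.
set a := cond s _ _; set b := cond t _ _; set d := cond r _ _ => E1 E2 E3.
have a0 : a != 0 by apply: A0.
have b0 : b != 0 by apply: A0.
have d0 : d != 0 by apply: A0.
apply: (mulIf (mulf_neq0 a0 (mulf_neq0 b0 d0))).
transitivity ((pair_cond t r x z * a) * (pair_cond r s z y * b) *
    (pair_cond s t y x * d)); first by ring.
by rewrite E1 E3 E2; ring.
Qed.

Hypothesis third : forall t s : T, exists r : T, (r != t) && (r != s).

Lemma single_site_marginals : exists p : T -> X' -> R,
  [/\ forall t x, 0 < p t x,
      forall t, \sum_x p t x = 1 &
      forall (t s : T) x y, t != s ->
        p s y * pair_cond t s x y = p t x * pair_cond s t y x].
Proof.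
exact: (@pairwise_marginals R T X' (point : X') pair_cond pair_cond_gt0
  pair_cond_sum pair_cond_cycle third).
Qed.

Section Weights.
Variable p : T -> X' -> R.
Hypothesis p_gt0 : forall t x, 0 < p t x.
Hypothesis p_sum : forall t, \sum_x p t x = 1.
Hypothesis p_pair : forall (t s : T) x y, t != s ->
  p s y * pair_cond t s x y = p t x * pair_cond s t y x.

(** With p as the conditional given the empty configuration, normalization and
    the exchange identity extend to empty boundary conditions, and a chain
    product has no special first factor. *)
Definition cond0 t S s := if `[< S = set0 >] then p t (s t) else cond t S s.

Let emptyP S : (S = set0) \/ S !=set0.
Proof. by have [->|/set0P] := eqVneq S set0; [left|right]. Qed.

Lemma cond0_set0 t s : cond0 t set0 s = p t (s t).
Proof. by rewrite /cond0 asboolT. Qed.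

Lemma cond0N t S s : S !=set0 -> cond0 t S s = cond t S s.
Proof. by move=> [u Su]; rewrite /cond0 asboolF // => S0; rewrite S0 in Su. Qed.

Lemma cond0_gt0 t S s : ~ S t -> 0 < cond0 t S s.
Proof.
by move=> St; have [->|S0] := emptyP S; rewrite ?cond0_set0 // cond0N // cond_gt0.
Qed.

Lemma cond0_sum t S s : ~ S t -> \sum_x cond0 t S (upd s t x) = 1.
Proof.
move=> St; have [->|S0] := emptyP S.
  by rewrite -(p_sum t); apply: eq_bigr => x _; rewrite cond0_set0 upd_same.
by rewrite -(cond_sum s S0 St); apply: eq_bigr => x _; rewrite cond0N.
Qed.

Lemma cond0_ext t S s s' : {in t |` S, s =1 s'} -> cond0 t S s = cond0 t S s'.
Proof.
move=> ss; rewrite /cond0; case: ifP => _; last exact: cond_ext.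
by rewrite ss // in_setU in_set1 eqxx.
Qed.

Lemma cond0_swap (t s : T) S r : t != s -> ~ S t -> ~ S s ->
  cond0 t S r * cond0 s (t |` S) r = cond0 s S r * cond0 t (s |` S) r.
Proof.
move=> ts St Ss.
have N0 u : u |` S !=set0 by exists u; left.
rewrite ![cond0 _ (_ |` S) _]cond0N //.
have [->|S0] := emptyP S; last by rewrite !cond0N //; exact: cond_swap.
by rewrite !cond0_set0 !setU0 !pair_condE (p_pair _ _ ts).
Qed.

(** The sites join the chain from the tail of the list to its head. *)
Fixpoint weight (l : seq T) s : R :=
  if l is t :: l' then weight l' s * cond0 t [set` l'] s else 1.

Lemma set_consU (t : T) (l : seq T) : [set` t :: l] = t |` [set` l].
Proof.
apply/seteqP; split=> u /=; first by rewrite inE => /orP[/eqP ->|]; [left|right].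
by case=> [->|ul]; rewrite inE ?eqxx // ul orbT.
Qed.

Lemma weight_ext l s s' : {in l, s =1 s'} -> weight l s = weight l s'.
Proof.
elim: l => //= t l IH ss.
rewrite IH => [|u ul]; last by rewrite ss // inE ul orbT.
congr (_ * _); apply: cond0_ext => u; rewrite -set_consU inE => tl.
exact: ss.
Qed.

Lemma weight_gt0 l s : uniq l -> 0 < weight l s.
Proof.
elim: l => //= t l IH /andP[tl ul]; rewrite mulr_gt0 ?IH //.
by apply: cond0_gt0; exact/negP.
Qed.

(** Any site of a chain can be moved to its end, one exchange at a time. *)
Lemma weight_rem l t s : uniq l -> t \in l ->
  weight l s = weight (rem t l) s * cond0 t [set` rem t l] s.
Proof.
elim: l => // u l IH /= /andP[ul uniql]; rewrite inE.
have [->//|ut /= tl] := eqVneq t u.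
rewrite /= (IH uniql tl).
have lE : [set` l] = t |` [set` rem t l].
  rewrite -set_consU; apply/seteqP; split=> v /=.
    by rewrite (perm_mem (perm_to_rem tl)).
  by rewrite (perm_mem (perm_to_rem tl)).
rewrite lE set_consU -!mulrA; congr (_ * _); apply: cond0_swap => //=.
  by rewrite mem_rem_uniq // inE /= eqxx.
by move=> /mem_rem; exact/negP.
Qed.

Lemma weight_perm l l' s : uniq l -> perm_eq l l' -> weight l s = weight l' s.
Proof.
elim: l l' => [|t l IH] l' ul ll'.
  by rewrite perm_sym in ll'; move/perm_nilP: ll' => ->.
have ul' : uniq l' by rewrite -(perm_uniq ll').
have tl' : t \in l' by rewrite -(perm_mem ll') mem_head.
rewrite (weight_rem _ ul' tl') /=.
have ll : perm_eq l (rem t l').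
  by rewrite -(perm_cons t); apply: perm_trans ll' _; exact: perm_to_rem.
move: ul => /= /andP[_ ul]; rewrite (IH _ ul ll); congr (_ * cond0 _ _ _).
by apply/seteqP; split=> u /=; rewrite (perm_mem ll).
Qed.

Lemma weight_sum l t s : t \notin l ->
  \sum_x weight (t :: l) (upd s t x) = weight l s.
Proof.
move=> tl /=; rewrite -[RHS]mulr1 -(@cond0_sum t [set` l] s); last exact/negP.
rewrite mulr_sumr; apply: eq_bigr => x _; congr (_ * _).
apply: weight_ext => u ul; rewrite upd_other //.
by apply: contraNneq tl => <-.
Qed.

(** The chain products along the enumeration define the field. A finite set is
    reached from an initial segment containing it by summing out the other
    sites, after the chain has been reordered so that these come last. *)
Lemma field_of_weights (e : nat -> T) : bijective e ->
  exists P, forall l s, uniq l -> prob P (res [set` l] s) = weight l s.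
Proof.
move=> e_bij; have e_inj := bij_inj e_bij; case: (e_bij) => f eK fK.
pose init n := rev [seq e i | i <- iota 0 n].
have initS n : init n.+1 = e n :: init n.
  by rewrite /init -addn1 iotaD map_cat rev_cat.
have init_uniq n : uniq (init n) by rewrite rev_uniq map_inj_uniq ?iota_uniq.
have initP n t : (t \in init n) = (f t < n)%N.
  by rewrite mem_rev -{1}(fK t) mem_map // mem_iota.
have [P Pinit] : exists P : random_field hX T, forall n s,
    P (cyl (e @` `I_n) s) = (weight (init n) s)%:E.
  apply: sequential_extension => // [n s|n s s' ss|n s].
  - by apply/ltW/weight_gt0.
  - by apply: weight_ext => t; rewrite initP -{2 3}(fK t); exact: ss.
  - by rewrite initS weight_sum // initP eK ltnn.
exists P.
have step t l : uniq (t :: l) ->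
    (forall s, prob P (res [set` t :: l] s) = weight (t :: l) s) ->
    forall s, prob P (res [set` l] s) = weight l s.
  move=> /= /andP[tl ul] Pl s.
  rewrite (@prob_sum _ _ _ _ _ _ _ t) //; last exact/negP.
  by rewrite -(weight_sum s tl); apply: eq_bigr => x _; rewrite -set_consU Pl.
move=> l s ul.
pose n := \max_(t <- l) (f t).+1.
pose l2 := [seq t <- init n | t \notin l].
have ini : perm_eq (init n) (l2 ++ l).
  apply: uniq_perm => // [|t].
    rewrite cat_uniq filter_uniq // ul andbT; apply/hasPn => t tl.
    by rewrite mem_filter tl.
  rewrite mem_cat mem_filter; have [tl|] //= := boolP (t \in l).
    rewrite initP /n.
    exact: (@leq_bigmax_seq _ l xpredT (fun t => (f t).+1) t).
  by rewrite orbF.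
have ul2 : uniq (l2 ++ l) by rewrite -(perm_uniq ini).
have : forall r, prob P (res [set` l2 ++ l] r) = weight (l2 ++ l) r.
  move=> r; have -> : [set` l2 ++ l] = e @` `I_n.
    apply/seteqP; split=> t /=.
      by rewrite -(perm_mem ini) initP => tn; exists (f t).
    by move=> [i ni <-]; rewrite -(perm_mem ini) initP eK.
  rewrite -(weight_perm r (init_uniq n) ini); apply: EFin_inj.
  by rewrite -probE ?Pinit //; apply: finite_image; exact: finite_II.
elim: l2 ul2 {ini} => [_|t l2 IH ul2 Pl]; first exact.
by apply: IH => [|r]; [move: ul2 => /= /andP[]|exact: step Pl r].
Qed.

(** The exceptional set of the almost sure identity is null, while by positivity
    every configuration on the finite set S has positive probability. *)
Lemma specified_chain P t S s : positive_field P -> specified_by q P ->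
    finite_set S -> S !=set0 -> ~ S t ->
  prob P (res (t |` S) s) = prob P (res S s) * cond t S s.
Proof.
move=> Ppos Pq Sfin S0 St.
have [A [mA A0 sA]] := Pq t S (outside_set1 S0 St).
have P0 : prob P (res S s) != 0 by rewrite gt_eqF // Ppos.
suff [/(_ Sfin) PE _] : cond_prob P t (res S s) (s t) (q t (res S s) (s t)).
  by rewrite /cond -PE /cond_ratio concat_pt // upd_id mulrC divfK.
apply: contrapT => ncond; move/eqP: P0; apply; apply: EFin_inj.
rewrite -probE //.
apply: (subset_measure0 _ _ _ (A0 : P (restr (@subsetT _ S) @^-1` A) = 0%E)).
- exact: measurable_cyl.
- by rewrite -[_ @^-1` _]setTI; exact: measurable_restr.
- move=> z zs; suff : A (res S s) by rewrite -zs.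
  by apply: sA => /(_ (s t)).
Qed.

(** Two-site marginals, computed in both orders, show that the single-site
    marginals of P solve the balance equations of p; they equal p by
    [pairwise_marginals_unique], and the chain rule does the rest. *)
Lemma specified_weight P l s : positive_field P -> specified_by q P ->
  uniq l -> prob P (res [set` l] s) = weight l s.
Proof.
move=> Ppos Pq.
pose p' (t : T) (x : X') := prob P (res [set t] (fun=> x)).
have p'E (t : T) r : prob P (res [set t] r) = p' t (r t).
  by rewrite /p'; congr (prob P _); apply/res_eq => u; rewrite inE => ->.
have p'_sum t : \sum_x p' t x = 1.
  rewrite -(prob_total P (fun=> point)) (@prob_sum _ _ _ _ _ _ _ t) //.
  by apply: eq_bigr => x _; rewrite setU0 p'E upd_same.
have p'_pair (t u : T) x y : t != u ->
    p' u y * pair_cond t u x y = p' t x * pair_cond u t y x.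
  move=> tu; have ut : u != t by rewrite eq_sym.
  pose c := upd (fun=> y) t x.
  have [ct cu] : c t = x /\ c u = y by rewrite /c upd_same upd_other.
  have := @specified_chain P t [set u] c Ppos Pq
    (finite_set1 u) (set1_nonempty u) (notin_set1 tu).
  have := @specified_chain P u [set t] c Ppos Pq
    (finite_set1 t) (set1_nonempty t) (notin_set1 ut).
  by rewrite setUC !pair_condE !p'E ct cu => -> <-.
elim: l => [_|t l IH /= /andP[tl ul]]; first by rewrite set_nil prob_total.
rewrite -IH // set_consU; case: l tl {IH ul} => [_|u l tl].
  rewrite set_nil setU0 prob_total mul1r cond0_set0 p'E.
  have [u /andP[ut _]] := third t t.
  by apply: (@pairwise_marginals_unique R T X' pair_cond pair_cond_gt0 p' p u t)
    => // x; [exact: p'_pair|exact: p_pair].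
have u0 : [set` u :: l] !=set0 by exists u; rewrite /= mem_head.
by rewrite cond0N // specified_chain //; exact/negP.
Qed.

Theorem specified_field (e : nat -> T) : bijective e ->
  exists P : random_field hX T,
    [/\ positive_field P,
        specified_by q P,
        forall t S (z : conf hX S) x,
          outside [set t] S -> finite_set S -> cond_ratio P t z x = q t z x
      & forall P' : random_field hX T,
          positive_field P' -> specified_by q P' ->
          forall A : set (conf hX [set: T]), measurable A -> P' A = P A].
Proof.
move=> e_bij; have [P Pw] := field_of_weights e_bij.
have finE S : finite_set S -> exists2 l, uniq l & S = [set` l].
  move=> Sfin; exists (finmap.enum_fset (fset_set S)).
    exact: finmap.fset_uniq.
  by rewrite -{1}(fset_setK Sfin).
have Pratio t S (z : conf hX S) x :
    outside [set t] S -> finite_set S -> cond_ratio P t z x = q t z x.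
  move=> [S0 St] Sfin; have [s ->] := res_surj z.
  have {}St : ~ S t by move=> /St; apply.
  rewrite /cond_ratio concat_pt //.
  have [l ul lE] := finE _ Sfin; move: S0 St; rewrite lE => S0 tl.
  rewrite -set_consU !Pw //=; last by rewrite ul andbT; exact/negP.
  rewrite (@weight_ext l (upd s t x) s); last first.
    by move=> u ul'; rewrite upd_other //; apply: contra_notN tl => /eqP <-.
  rewrite mulrC mulKf ?gt_eqF ?weight_gt0 // cond0N //.
  by rewrite /cond res_upd // upd_same.
exists P; split=> //.
- move=> V x Vfin; have [s ->] := res_surj x; have [l ul ->] := finE _ Vfin.
  by rewrite Pw // weight_gt0.
(* On an infinite support the ratios along L are values of q, whose convergence
   is the continuity condition on q. *)
- move=> t S [S0 St]; apply: aeW => z x; split=> [Sfin|Sinf]; first exact: Pratio.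
  move=> L LS Lex; have [_ _ q3] := q_spec.
  have := q3 t S z x (conj S0 St) L LS Lex.
  suff -> : (fun n => cond_ratio P t (restr (LS n) z) x) =
            (fun n => q t (restr (LS n) z) x) by [].
  apply/funext => n; case: Lex => L0 Lfin _ _.
  by apply: Pratio => //; split=> //; apply: subset_trans St.
- move=> P' P'pos P'q A; apply: random_field_unique => S s Sfin.
  by have [l ul ->] := finE _ Sfin; rewrite Pw // specified_weight.
Qed.
End Weights.
End Specification.

(** * The lattice *)

Lemma third_site (T : choiceType) (e : nat -> T) : bijective e ->
  forall t s : T, exists r : T, (r != t) && (r != s).
Proof.
move=> [f eK fK] t s; exists (e (f t + f s).+1).
by apply/andP; split; apply/eqP => /(congr1 f); rewrite eK => /eqP;
  rewrite gtn_eqF // ltnS ?leq_addr ?leq_addl.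
Qed.

Lemma lattice_enum (d : nat) : (0 < d)%N ->
  exists e : nat -> 'rV[int]_d, bijective e.
Proof.
case: d => // d _.
have inf : infinite_set [set: 'rV[int]_d.+1].
  move=> fin; apply: infinite_nat.
  rewrite -(@preimage_setT _ _ (fun n : nat => const_mx n%:Z : 'rV[int]_d.+1)).
  apply: finite_preimage fin => m n _ _ /matrixP/(_ ord0 ord0).
  by rewrite !mxE => -[].
have /card_set_bijP[f] := eq_card_nat (countableP _) inf.
by rewrite setTT_bijective => -[e fK eK]; exists e, f.
Qed.

Unset Implicit Arguments.

Theorem theorem15 (R : realType) (X : {fset R}) (hX : (1 < #|` X|)%N)
    (d : nat) (hd : (0 < d)%N) (q : kernels hX 'rV[int]_d) :
  full_1_specification q ->
  exists P : random_field hX 'rV[int]_d,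
    [/\ positive_field P,
        specified_by q P,
        forall (t : 'rV[int]_d) (S : set 'rV[int]_d) (z : conf hX S)
               (x : state hX),
          outside [set t] S -> finite_set S -> cond_ratio P t z x = q t S z x
      & forall P' : random_field hX 'rV[int]_d,
          positive_field P' -> specified_by q P' ->
          forall A : set (conf hX [set: 'rV[int]_d]),
            measurable A -> P' A = P A].
Proof.
move=> q_spec; have [e e_bij] := lattice_enum hd.
have third := third_site e_bij.
have [p [p_gt0 p_sum p_pair]] := single_site_marginals q_spec third.
exact: (specified_field q_spec third p_gt0 p_sum p_pair e_bij).
Qed.
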